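(* For each linear order $L$ the following conditions are equivalent: (a) $L$ is isomorphic to a maximal chain in the poset $\langle [\omega]^{\omega|\omega},\subseteq\rangle$, where $[\omega]^{\omega|\omega}=\{A\subseteq\omega: |A|=|\omega\setminus A|=\aleph_0\}$; (b) $L$ is $\mathbb{R}$-embeddable, weakly Boolean and without end-points; (c) $L$ is order-isomorphic to $K\setminus\{0,1\}$ for some compact nowhere dense set $K\subseteq[0,1]$ (in the real line) satisfying $0,1\in K'$, where $K'$ is the set of accumulation points of $K$ in $\mathbb{R}$.
   Context: A linear order is $\mathbb{R}$-embeddable if it is order-isomorphic to a subset of the real line. A linear order $L$ is Dedekind-complete if every nonempty subset with an upper bound has a supremum; it has dense jumps if for all $a<b$ in $L$ there are $c<d$ in $[a,b]_L$ with $(c,d)_L=\emptyset$; it is weakly Boolean if it is Dedekind-complete and has dense jumps. End-points are a minimum or maximum element.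
   Formalization: The linear order L is assumed nonempty: for empty L condition (b) holds vacuously while (a) and (c) fail. *)

(* Defs.v *)
From mathcomp Require Import all_boot all_order all_algebra.
From mathcomp Require Import all_classical all_reals all_analysis.
Set Implicit Arguments.
Unset Strict Implicit.
Unset Printing Implicit Defensive.
Import Order.TTheory GRing.Theory Num.Theory.
Import numFieldNormedType.Exports.
Local Open Scope classical_set_scope.
Local Open Scope ring_scope.

Definition order_isomorphic_to {disp : Order.disp_t} (L : orderType disp) {T : Type}
    (r : T -> T -> Prop) (B : set T) : Prop :=
  exists f : L -> T,
    set_bij [set: L] B f /\ forall x y : L, (x <= y)%O <-> r (f x) (f y).

Definition real_le {R : realType} (x y : R) : Prop := x <= y.

Definition R_embeddable (R : realType) {disp : Order.disp_t} (L : orderType disp) :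
    Prop :=
  exists S : set R, order_isomorphic_to L real_le S.

Definition dedekind_complete {disp : Order.disp_t} (L : orderType disp) : Prop :=
  forall A : set L, A !=set0 -> has_ubound A -> supremums A !=set0.

Definition dense_jumps {disp : Order.disp_t} (L : orderType disp) : Prop :=
  forall a b : L, (a < b)%O ->
    exists c d : L,
      [/\ c \in `[a, b], d \in `[a, b], (c < d)%O & [set` `]c, d[] = set0].

Definition weakly_boolean {disp : Order.disp_t} (L : orderType disp) : Prop :=
  dedekind_complete L /\ dense_jumps L.

Definition without_endpoints {disp : Order.disp_t} (L : orderType disp) : Prop :=
  ~ (exists m : L, forall x : L, (m <= x)%O) /\
  ~ (exists M : L, forall x : L, (x <= M)%O).

(* [omega]^{omega|omega}; every infinite subset of nat has cardinality
   aleph_0. *)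
Definition inf_coinf : set (set nat) :=
  [set A | infinite_set A /\ infinite_set (~` A)].

Definition chain_in {T : Type} (P : set T) (r : T -> T -> Prop) (C : set T) :
    Prop :=
  C `<=` P /\ total_on C r.

Definition maximal_chain_in {T : Type} (P : set T) (r : T -> T -> Prop)
    (C : set T) : Prop :=
  chain_in P r C /\
  forall D : set T, chain_in P r D -> C `<=` D -> D = C.

Definition nowhere_dense {T : topologicalType} (K : set T) : Prop :=
  interior (closure K) = set0.

(* Main.v *)
Require Import Defs.
From mathcomp Require Import all_boot all_order all_algebra.
From mathcomp Require Import all_classical all_reals all_analysis.
From mathcomp Require Import lra.
Import Order.TTheory GRing.Theory Num.Theory.
Import numFieldNormedType.Exports.
Local Open Scope classical_set_scope.
Local Open Scope ring_scope.

(** A maximal chain [C] of infinite coinfinite sets, with its intersection and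
    union added, is closed under unions and intersections and has a jump at
    every number separating two of its members.  A normalized sum of weights
    [2^-n] maps it strictly increasingly and continuously onto a compact set
    [K], the jumps becoming gaps that make [K] nowhere dense; the end-points of
    [K] are accumulation points because [C] has no end-points.

    From [K], suprema and the two sides of a gap stay in [K], which gives the
    order properties (b).

    From (b), enumerate without repetition the elements [e n] that have an
    immediate predecessor (they are countable, since jumps in a subset of the
    line enclose disjoint intervals) and map [x] to [{n | e n <= x}].  Crossing a
    jump adds exactly one number, so nothing can be inserted in the image. *)

(** * Infinite sets and immediate successors in linear orders *)

(** Induction on a list supposed to exhaust [A] yields an element of [A] that neither precedes nor
    equals any listed one: when the new entry [a] violates this, move to some [z] with [r a z]. *)
Lemma infinite_set_unbounded {T : choiceType} (r : T -> T -> Prop) (A : set T) :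
    (forall x, ~ r x x) -> (forall x y z, r x y -> r y z -> r x z) ->
    A !=set0 -> (forall x, A x -> exists2 y, A y & r x y) -> infinite_set A.
Proof.
move=> rirr rtr A0 Ar /finite_seqP[s As].
suff [y [Ay ys]] : exists y, A y /\ forall x, x \in s -> A x -> ~ r y x /\ y <> x.
  by have := Ay; rewrite {1}As => /ys/(_ Ay)[].
elim: s {As} => [|a s [y [Ay ys]]]; first by case: A0 => y; exists y.
have [[Aa ya]|nya] := pselect (A a /\ (r y a \/ y = a)); last first.
  exists y; split=> // x; rewrite inE => /orP[/eqP -> Aa|/ys //].
  by split=> ?; apply: nya; split=> //; [left|right].
have [z Az az] := Ar _ Aa; have yz : r y z by case: ya => [/rtr|->]; [exact|].
exists z; split=> // x; rewrite inE => /orP[/eqP -> _|/ys + Ax].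
  by split=> [za|az']; [apply: (rirr a); exact: rtr za|apply: (rirr z); rewrite {1}az'].
by move=> /(_ Ax)[nyx _]; split=> [zx|zx]; apply: nyx; [exact: rtr zx|rewrite -zx].
Qed.

Definition successor {d : Order.disp_t} {L : orderType d} (x y : L) : Prop :=
  (x < y)%O /\ forall z, (x < z)%O -> (y <= z)%O.

Lemma successor_inj {d : Order.disp_t} {L : orderType d} {x y z : L} :
  successor x y -> successor x z -> y = z.
Proof.
move=> [xy ymin] [xz zmin].
by apply/eqP; rewrite eq_le ymin // zmin.
Qed.

Lemma unbounded_without_endpoints {d : Order.disp_t} {L : orderType d} :
  without_endpoints L ->
  (forall x : L, exists y, (y < x)%O) /\ (forall x : L, exists y, (x < y)%O).
Proof.
move=> [nmin nmax]; split=> x; apply: contrapT => nx; [apply: nmin|apply: nmax];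
  exists x => y; rewrite leNgt; apply/negP => xy; by apply: nx; exists y.
Qed.

Lemma dense_successor {d : Order.disp_t} {L : orderType d} {a b : L} :
  dense_jumps L -> (a < b)%O ->
  exists x y : L, [/\ (a <= x)%O, (y <= b)%O & successor x y].
Proof.
move=> jL /jL[x [y []]].
rewrite !in_itv /= => /andP[ax _] /andP[_ yb] xy gap.
exists x, y; split=> //; split=> // z xz; rewrite leNgt; apply/negP => zy.
by suff : set0 z by []; rewrite -gap /= in_itv /= xz zy.
Qed.

(** A rational chosen in the gap just below the image of each successor grows strictly with the
    successor, so distinct successors get distinct rationals. Elements without a predecessor get the
    dummy value 0. *)
Lemma countable_successors {R : realType} {d : Order.disp_t} {L : orderType d} :
  R_embeddable R L -> countable [set y : L | exists x, successor x y].
Proof.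
move=> [S [f [[_ finj _] fle]]].
have flt x y : (x < y)%O -> f x < f y.
  move=> xy; rewrite lt_neqAle; apply/andP; split; last exact/(fle x y).1/ltW.
  by apply/eqP => /finj xyE; rewrite xyE ?inE // ltxx in xy.
have /choice[q qP] y : exists q : rat, (exists x, successor x y) ->
    exists2 x, successor x y & f x < ratr q < f y.
  have [[x xy]|nxy] := pselect (exists x, successor x y); last by exists 0 => /nxy.
  have [q /[!in_itv]/= xqy] := rat_in_itvoo (flt _ _ xy.1).
  by exists q => _; exists x.
have q_lt y z : (exists x, successor x z) -> (exists x, successor x y) ->
    (y < z)%O -> q y < q z.
  move=> /qP[x [_ zmin] /andP[xq _]] /qP[_ _ /andP[_ qy]] yz.
  have yx : (y <= x)%O by rewrite leNgt; apply/negP => /zmin; rewrite leNgt yz.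
  by rewrite -(ltr_rat R) (lt_trans qy)// (le_lt_trans _ xq)//; apply/fle.
apply/countable_injP; exists (fun y => pickle (q y)) => y z /[!inE] ys zs.
move=> /(pcan_inj pickleK) qE.
by case: (ltgtP y z) => // yz; [have := q_lt y z zs ys yz|have := q_lt z y ys zs yz];
  rewrite qE ltxx.
Qed.

(** There is no maximum and jumps are dense, so a successor lies above every element; the countable
    set of successors is therefore infinite. *)
Lemma enum_successors {R : realType} {d : Order.disp_t} {L : orderType d} :
    [set: L] !=set0 -> R_embeddable R L -> dense_jumps L -> without_endpoints L ->
  exists e : nat -> L, [/\ injective e, forall n, exists x, successor x (e n) &
    forall y, (exists x, successor x y) -> exists n, e n = y].
Proof.
move=> [x0 _] /countable_successors cJ jL /unbounded_without_endpoints[_ gt_ex].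
have succ_gt (x : L) : exists2 y, (exists x, successor x y) & (x < y)%O.
  have [y /(dense_successor jL)[a [b [xa _ ab]]]] := gt_ex x.
  by exists b; [exists a|apply: le_lt_trans ab.1].
have iJ : infinite_set [set y : L | exists x, successor x y].
  apply: (infinite_set_unbounded (fun x y : L => (x < y)%O)) => [x|x y z||x _].
  - by rewrite ltxx.
  - exact: lt_trans.
  - by have [y] := succ_gt x0; exists y.
  - exact: succ_gt.
have /card_set_bijP[f [_ finj fsurj]] :
    ([set y : L | exists x, successor x y] #= [set: nat])%card.
  by rewrite card_eq_le; apply/andP; split=> //; exact/infiniteP.
have /choice[e eP] n : exists y, (exists x, successor x y) /\ f y = n.
  by have [y] := fsurj n I; exists y.
exists e; split=> [m n emn|n|y ys].
- by rewrite -(eP m).2 -(eP n).2 emn.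
- exact: (eP n).1.
- exists (f y); apply: finj; rewrite ?inE; first exact: (eP _).1.
    exact: ys.
  exact: (eP _).2.
Qed.

(** * From the order properties to a maximal chain *)

Lemma embeddable_maximal_chain {R : realType} {d : Order.disp_t} {L : orderType d} :
    [set: L] !=set0 ->
    [/\ R_embeddable R L, weakly_boolean L & without_endpoints L] ->
  exists C : set (set nat), maximal_chain_in inf_coinf (@subset nat) C /\
    order_isomorphic_to L (@subset nat) C.
Proof.
move=> L0 [RL [cL jL] wL].
have [e [einj eS eJ]] := enum_successors L0 RL jL wL.
have [lt_ex gt_ex] := unbounded_without_endpoints wL; case: L0 => x0 _.
have e_between (x y : L) : (x < y)%O -> exists n, (x < e n <= y)%O.
  move=> /(dense_successor jL)[a [b [xa yb ab]]].
  have [|n nb] := eJ b; first by exists a.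
  by exists n; rewrite nb yb (le_lt_trans xa)// ab.1.
pose D (x : L) : set nat := [set n | (e n <= x)%O].
have DS x y : (x <= y)%O <-> D x `<=` D y.
  split=> [xy n|Dxy]; first by move/le_trans; exact.
  rewrite leNgt; apply/negP => /e_between[n /andP[yn nx]].
  by have := Dxy n nx; rewrite /D /= leNgt yn.
have DP x : inf_coinf (D x).
  split.
    apply: (infinite_set_unbounded (fun m n => (e n < e m)%O)) => [n|n m p||n nx].
    - by rewrite ltxx.
    - by move=> nm mp; exact: lt_trans nm.
    - by have [y /e_between[n /andP[_ nx]]] := lt_ex x; exists n.
    (* Two steps down are taken because [e_between] bounds [e m] only weakly by [y], while
       [e m < e n] must be strict. *)
    - have [y yn] := lt_ex (e n); have [z zy] := lt_ex y.
      have [m /andP[_ my]] := e_between _ _ zy; have mn := le_lt_trans my yn.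
      by exists m => //; exact: le_trans (ltW mn) nx.
  apply: (infinite_set_unbounded (fun m n => (e m < e n)%O)) => [n|n m p||n nx].
  - by rewrite ltxx.
  - exact: lt_trans.
  - have [y /e_between[n /andP[xn _]]] := gt_ex x; exists n.
    by rewrite /D /=; apply/negP; rewrite -ltNge.
  - have [y /e_between[m /andP[nm _]]] := gt_ex (e n); exists m => // mx.
    by apply: nx; exact: le_trans (ltW nm) mx.
exists (range D); split; last first.
  exists D; split=> //; split=> [x _|x y _ _ Dxy|_ [x _ <-]]; last by exists x.
    by exists x.
  by apply/eqP; rewrite eq_le; apply/andP; split; apply/DS; rewrite Dxy.
have chD : chain_in inf_coinf (@subset nat) (range D).
  split=> [_ [x _ <-] //|_ _ [x _ <-] [y _ <-]].
  by case/orP: (le_total x y) => /DS; [left|right].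
(* For [Y] in a larger chain, let [s] be the supremum of all [x] with [D x] inside [Y]. Then [Y] is
   either [D s] or [D (e m)], with [e m] the successor of [s]. *)
split=> // E [EP Etot] DE; apply/seteqP; split=> // Y EY.
have Ycmp x : D x `<=` Y \/ Y `<=` D x by apply: Etot => //; apply: DE; exists x.
have [Yinf Ycoinf] := EP _ EY.
have DY n x : Y n -> (x < e n)%O -> D x `<=` Y.
  by move=> Yn xn; case: (Ycmp x) => // /(_ n Yn); rewrite /D /= leNgt xn.
pose A := [set x | D x `<=` Y].
have [n0 Yn0] := infinite_setN0 Yinf; have [m0 nYm0] := infinite_setN0 Ycoinf.
have A0 : A !=set0 by have [x xn0] := lt_ex (e n0); exists x; exact: DY xn0.
have ubA : has_ubound A.
  exists (e m0) => x xA; rewrite leNgt; apply/negP => m0x.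
  by apply: nYm0; apply: xA; exact: ltW.
have [s [As sA]] := cL _ A0 ubA.
(* The supremum need not be known to lie in [A]: if [e n <= s], the predecessor [c] of [e n] is no
   upper bound of [A], and any [a] in [A] above [c] is already at least [e n]. *)
have DsY : D s `<=` Y.
  move=> n ns; have [c [cn cmin]] := eS n.
  have [a Aa ca] : exists2 a, A a & (c < a)%O.
    apply: contrapT => nA; have : (s <= c)%O.
      apply: sA => a Aa; rewrite leNgt; apply/negP => ca.
      by apply: nA; exists a.
    by rewrite leNgt (lt_le_trans cn).
  by apply: Aa; exact: cmin.
(* The predecessor [c] of [e m] is in [A] by [DY], so [c <= s]; and [c < s] would give
   [e m <= s]. *)
have Ysucc m : Y m -> ~ D s m -> successor s (e m).
  move=> Ym /negP; rewrite -ltNge => sm; have [c cm] := eS m.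
  suff <- : c = s by [].
  apply/eqP; rewrite eq_le; apply/andP; split; first exact/As/DY/cm.1.
  by rewrite leNgt; apply/negP => /cm.2; rewrite leNgt sm.
have [YDs|/existsNP[m /not_implyP[Ym nm]]] := pselect (Y `<=` D s).
  by exists s => //; apply/seteqP.
have sm := Ysucc _ Ym nm; exists (e m) => //; apply/seteqP; split=> n.
  rewrite /D /= le_eqVlt => /orP[/eqP/einj -> //|nm']; apply: DsY.
  by rewrite /D /= leNgt; apply/negP => /sm.2; rewrite leNgt nm'.
move=> Yn; have [ns|/(Ysucc _ Yn) sn] := pselect (D s n).
  exact: le_trans ns (ltW sm.1).
by rewrite /D /= (successor_inj sn sm).
Qed.

(** * From compact nowhere dense sets to the order properties *)

Lemma closure_inf {R : realType} {A : set R} :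
  A !=set0 -> has_lbound A -> closure A (inf A).
Proof.
move=> A0 lA B /nbhs_ballP[e e0 eB].
have [x Ax xe] := inf_adherent e0 (conj A0 lA).
exists x; split=> //; apply: eB; rewrite /ball /= ltr_distlC.
have := ge_inf lA Ax; lra.
Qed.

(** Some [t] between [a] and [b] misses [K], as otherwise the midpoint would be interior. The last
    point of [K] below [t] and the first above it exist by closedness and bound the gap. *)
Lemma closed_nowhere_dense_gap {R : realType} {K : set R} {a b : R} :
    closed K -> nowhere_dense K -> K a -> K b -> a < b ->
  exists x y, [/\ K x, K y, a <= x < y, y <= b & forall z, K z -> x < z -> y <= z].
Proof.
move=> Kcl Knd Ka Kb ab.
have [t [/andP[at_ tb] nKt]] : exists t, a < t < b /\ ~ K t.
  apply: contrapT => nt; pose m := (a + b) / 2.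
  suff : interior (closure K) m by rewrite Knd.
  have abm : m \in `]a, b[ by rewrite in_itv /= /m; lra.
  apply: filterS (near_in_itvoo abm) => z; rewrite in_itv /= => abz.
  by apply: subset_closure; apply: contrapT => nKz; apply: nt; exists z.
pose A := [set z | K z /\ z <= t]; pose B := [set z | K z /\ t <= z].
have uA : has_ubound A by exists t => z [].
have lB : has_lbound B by exists t => z [].
have Aa : A a by split=> //; exact: ltW.
have Bb : B b by split=> //; exact: ltW.
have KA : K (sup A).
  by apply/Kcl/(closure_subset _ (closure_sup _ uA)); [move=> z []|exists a].
have KB : K (inf B).
  by apply/Kcl/(closure_subset _ (closure_inf _ lB)); [move=> z []|exists b].
have At : sup A <= t by apply: ge_sup; [exists a|move=> z []].
have tB : t <= inf B by apply: lb_le_inf; [exists b|move=> z []].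
have AB : sup A < inf B.
  rewrite lt_neqAle (le_trans At tB) andbT; apply/eqP => ABE; apply: nKt.
  by have -> : t = sup A by apply/eqP; rewrite eq_le At ABE tB.
exists (sup A), (inf B); split=> //.
- by rewrite AB andbT; exact: ub_le_sup.
- exact: ge_inf.
- move=> z Kz Az; apply: ge_inf => //; split=> //; rewrite leNgt; apply/negP => zt.
  by move: Az; rewrite ltNge ub_le_sup//; split=> //; exact: ltW.
Qed.

Lemma compact_nowhere_dense_boolean {R : realType} {d : Order.disp_t} {L : orderType d} :
    (exists K : set R, [/\ K `<=` `[0, 1], compact K, nowhere_dense K,
       limit_point K 0 /\ limit_point K 1 &
       order_isomorphic_to L real_le (K `\` [set 0; 1])]) ->
  [/\ R_embeddable R L, weakly_boolean L & without_endpoints L].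
Proof.
move=> [K [K01 /(compact_closed (@Rhausdorff R)) Kcl Knd [K0 K1] [f [fbij fle]]]].
have [fK finj fsurj] := fbij.
have {}fK x : K (f x) /\ 0 < f x < 1.
  have [Kfx /not_orP[f0 f1]] := fK x I; split=> //.
  have := K01 _ Kfx; rewrite /= in_itv /= => /andP[f0' f1'].
  by rewrite !lt_neqAle f0' f1' !andbT eq_sym; apply/andP; split; apply/eqP.
have fsur z : K z -> 0 < z < 1 -> exists x, f x = z.
  move=> Kz /andP[z0 z1]; have [|x _ <-] := fsurj z; last by exists x.
  by split=> // -[] /= zE; move: z0 z1; rewrite zE ltxx.
have flt x y : (x < y)%O <-> f x < f y.
  by rewrite !ltNge; split=> /negP nyx; apply/negP => yx; apply: nyx; apply/fle.
split; first by exists (K `\` [set 0; 1]), f.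
- split.
    move=> A [a Aa] [u uA].
    have fA : [set f x | x in A] !=set0 by exists (f a), a.
    have ufA : ubound [set f x | x in A] (f u) by move=> _ [x /uA/fle xu <-].
    (* The real supremum stays in [K] by closedness and strictly between 0 and 1 because it is
       squeezed between [f a] and [f u]; hence it is a value of [f]. *)
    have ufA' : has_ubound [set f x | x in A] by exists (f u).
    have [||s sE] := fsur (sup [set f x | x in A]).
    + apply/Kcl/(closure_subset _ (closure_sup fA ufA')) => _ [x _ <-].
      exact: (fK x).1.
    + have /andP[a0 _] := (fK a).2; have /andP[_ u1] := (fK u).2.
      apply/andP; split; last by apply: le_lt_trans u1; exact: ge_sup.
      by apply: (lt_le_trans a0); apply: ub_le_sup => //; exists a.
    + exists s; split=> x xA; apply/fle; rewrite /real_le sE.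
        by apply: ub_le_sup => //; exists x.
      by apply: ge_sup => // _ [y /xA/fle yx <-].
  move=> a b /flt ab; have [Ka /andP[a0 _]] := fK a; have [Kb /andP[_ b1]] := fK b.
  have [x [y [Kx Ky /andP[ax xy] yb gap]]] :=
    closed_nowhere_dense_gap Kcl Knd Ka Kb ab.
  have [|c cE] := fsur _ Kx; first by apply/andP; split; lra.
  have [|e eE] := fsur _ Ky; first by apply/andP; split; lra.
  have ac : (a <= c)%O by apply/fle; rewrite /real_le cE.
  have ce : (c < e)%O by apply/flt; rewrite cE eE.
  have eb : (e <= b)%O by apply/fle; rewrite /real_le eE.
  exists c, e; split=> //.
  + by rewrite in_itv /= ac (le_trans (ltW ce)).
  + by rewrite in_itv /= eb (le_trans ac (ltW ce)).
  + apply/seteqP; split=> // z; rewrite /= in_itv /= => /andP[/flt cz /flt ze].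
    by have := gap (f z) (fK z).1; lra.
- split=> -[m mext]; have [Km /andP[m0 m1]] := fK m.
    have [y [y0 Ky]] := K0 [set z | z < f m] (lt_nbhsl m0); rewrite /= => ym.
    have := K01 _ Ky; rewrite /= in_itv /= => /andP[y0' _].
    have [|x xE] := fsur _ Ky; first by rewrite lt_neqAle eq_sym y0 y0' (lt_trans ym).
    by have /fle := mext x; rewrite /real_le xE leNgt ym.
  have [y [y1 Ky]] := K1 [set z | f m < z] (lt_nbhsr m1); rewrite /= => my.
  have := K01 _ Ky; rewrite /= in_itv /= => /andP[_ y1'].
  have [|x xE] := fsur _ Ky; first by rewrite (lt_trans m0 my)/= lt_neqAle y1 y1'.
  by have /fle := mext x; rewrite /real_le xE leNgt my.
Qed.

(** * Binary weights of sets of natural numbers *)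

Definition binary_sum {R : realType} (A : set nat) (N : nat) : R :=
  \sum_(k < N) (if `[< A k >] then 2^-1 ^+ k.+1 else 0).

Lemma exp_half_gt0 {R : realType} n : 0 < (2^-1 : R) ^+ n.
Proof. by rewrite exprn_gt0// invr_gt0. Qed.

Lemma binary_sumS {R : realType} (A : set nat) N :
  binary_sum A N.+1 = binary_sum A N + (if `[< A N >] then 2^-1 ^+ N.+1 else 0) :> R.
Proof. by rewrite /binary_sum big_ord_recr. Qed.

Lemma binary_sum_homo {R : realType} (A : set nat) :
  {homo (binary_sum A : nat -> R) : m n / (m <= n)%N >-> m <= n}.
Proof.
apply: homo_leq => [//|x y z|N]; first exact: le_trans.
by rewrite binary_sumS lerDl; case: ifP => // _; exact/ltW/exp_half_gt0.
Qed.

(** The powers of 1/2 are the weights still unspent: they cancel while [M <= N], and afterwards [A]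
    can gain over [B] at most [2^-N - 2^-M]. Keeping [2^-M] on the left makes the induction go
    through. *)
Lemma binary_sum_prefix {R : realType} (A B : set nat) (N M : nat) :
    (forall k, (k < N)%N -> A k -> B k) ->
  binary_sum A M + 2^-1 ^+ M <= binary_sum B M + 2^-1 ^+ (minn M N) :> R.
Proof.
move=> AB; elim: M => [|M IH]; first by rewrite min0n /binary_sum !big_ord0.
rewrite !binary_sumS; have hM : 0 < (2^-1 : R) ^+ M.+1 := exp_half_gt0 _.
have hE : (2^-1 : R) ^+ M = 2^-1 ^+ M.+1 + 2^-1 ^+ M.+1 by rewrite exprS; lra.
have [NM|MN] := leqP N M.
  have := IH; rewrite !(minn_idPr _) ?leqW// hE.
  by case: ifP => _; case: ifP => _; lra.
have := IH; rewrite !(minn_idPl _) ?(ltnW MN)//.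
case: asboolP => [/(AB _ MN)/asboolT ->|_]; first lra.
by case: ifP => _; lra.
Qed.

Lemma binary_sum_sub {R : realType} (A B : set nat) (n N : nat) :
    A `<=` B -> ~ A n -> B n ->
  binary_sum A (n.+1 + N)%N + 2^-1 ^+ n.+1 <= binary_sum B (n.+1 + N)%N :> R.
Proof.
move=> AB nAn Bn.
have AB_ i : (if `[< A i >] then 2^-1 ^+ i.+1 else 0 : R) <=
    (if `[< B i >] then 2^-1 ^+ i.+1 else 0).
  case: asboolP => [/AB/asboolT -> //|_]; by case: ifP.
elim: N => [|N IH]; last first.
  by rewrite addnS (binary_sumS A) (binary_sumS B) addrAC; apply: lerD.
rewrite addn0 !binary_sumS (asboolT Bn) (asboolF nAn) addr0 lerD2r.
exact: ler_sum.
Qed.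

(* The second property is continuity for the product topology on subsets of [nat]. *)
Lemma exists_weight (R : realType) (X Y : set nat) : X `<=` Y -> X <> Y ->
  exists phi : set nat -> R, [/\ phi X = 0, phi Y = 1,
    forall A B, A `<=` B -> A <> B -> phi A < phi B &
    forall e, 0 < e -> exists N, forall A B,
      (forall k, (k < N)%N -> A k -> B k) -> phi A <= phi B + e].
Proof.
move=> XY XneY; pose psi A : R := sup (range (binary_sum A)).
have pref A B N : (forall k, (k < N)%N -> A k -> B k) -> forall M,
    binary_sum A M <= binary_sum B M + 2^-1 ^+ N :> R.
  move=> AB M; have := @binary_sum_prefix R _ _ _ M AB; have [NM|MN] := leqP N M.
    by have := @exp_half_gt0 R M; lra.
  by have := @exp_half_gt0 R N; lra.
have uR A : has_ubound (range (binary_sum A : nat -> R)).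
  exists 1 => _ [M _ <-]; have := @pref A set0 0%N _ M.
  rewrite [binary_sum set0 M]big1 ?add0r; first by rewrite expr0; exact.
  by move=> i _; rewrite asboolF.
have R0 A : range (binary_sum A : nat -> R) !=set0 by exists (binary_sum A 0%N), 0%N.
have le_psi A M : binary_sum A M <= psi A by apply: ub_le_sup => //; exists M.
have psi_lt A B : A `<=` B -> A <> B -> psi A < psi B.
  move=> AB AneB; have [n [Bn nAn]] : exists n, B n /\ ~ A n.
    apply: contrapT => nn; apply: AneB; apply/seteqP; split=> // n Bn.
    by apply: contrapT => nAn; apply: nn; exists n.
  (* A gap independent of the stage is needed, since strict inequality of partial sums could vanish
     in the supremum. *)
  suff : psi A <= psi B - 2^-1 ^+ n.+1 by have := @exp_half_gt0 R n.+1; lra.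
  apply: ge_sup => // _ [M _ <-].
  have := @binary_sum_homo R A M (n.+1 + M)%N (leq_addl _ _).
  by have := @binary_sum_sub R _ _ _ M AB nAn Bn; have := le_psi B (n.+1 + M)%N; lra.
have psi_pref A B N : (forall k, (k < N)%N -> A k -> B k) ->
    psi A <= psi B + 2^-1 ^+ N.
  move=> AB; apply: ge_sup => // _ [M _ <-].
  by have := pref _ _ _ AB M; have := le_psi B M; lra.
have XYlt := psi_lt _ _ XY XneY; pose q := psi Y - psi X.
have q0 : 0 < q by rewrite subr_gt0.
exists (fun A => (psi A - psi X) / q); split=> [||A B AB AneB|e e0].
- by rewrite subrr mul0r.
- by rewrite divff// gt_eqF.
- by rewrite ltr_pM2r ?invr_gt0// ltrD2r psi_lt.
- have eq0 : 0 < e * q by rewrite mulr_gt0.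
  (* This [N] makes [2^N] exceed [1 / (e * q)]; the factor [q] undoes the normalization. *)
  pose N := Num.Def.archi_bound (e * q)^-1; exists N => A B /psi_pref AB.
  rewrite -[e](@mulfK _ q) ?gt_eqF// -mulrDl ler_pM2r ?invr_gt0//.
  suff : 2^-1 ^+ N <= e * q by lra.
  rewrite exprVn -[leRHS]invrK lef_pV2 ?posrE ?invr_gt0 ?exprn_gt0//.
  by apply/ltW/upper_nthrootP.
Qed.

(** * Maximal chains of sets and their completion *)

(** Only finitely many witnesses are needed below [N], and in a chain the largest of them serves for
    all. This makes the union a limit of members for the product topology. *)
Lemma chain_bigcup_prefix {F : set (set nat)} (N : nat) :
  total_on F (@subset nat) -> F !=set0 ->
  exists2 X, F X & forall k, (k < N)%N -> (\bigcup_(Y in F) Y) k -> X k.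
Proof.
move=> Ftot [X0 FX0]; elim: N => [|N [X FX XN]]; first by exists X0.
have [[Y FY YN]|nN] := pselect ((\bigcup_(Y in F) Y) N); last first.
  by exists X => // k; rewrite ltnS leq_eqVlt => /orP[/eqP -> /nN|/XN].
have [XY|YX] := Ftot _ _ FX FY.
  by exists Y => // k; rewrite ltnS leq_eqVlt => /orP[/eqP ->//|kN /(XN k kN)/XY].
by exists X => // k; rewrite ltnS leq_eqVlt => /orP[/eqP -> _|/XN //]; exact: YX.
Qed.

Lemma chain_bigcap_prefix {F : set (set nat)} (N : nat) :
  total_on F (@subset nat) -> F !=set0 ->
  exists2 X, F X & forall k, (k < N)%N -> X k -> (\bigcap_(Y in F) Y) k.
Proof.
move=> Ftot [X0 FX0]; elim: N => [|N [X FX XN]]; first by exists X0.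
have [nN|/existsNP[Y /not_implyP[FY YN]]] := pselect ((\bigcap_(Y in F) Y) N).
  by exists X => // k; rewrite ltnS leq_eqVlt => /orP[/eqP ->|/XN].
have [XY|YX] := Ftot _ _ FX FY.
  by exists X => // k; rewrite ltnS leq_eqVlt => /orP[/eqP -> /XY|/XN].
exists Y => // k; rewrite ltnS leq_eqVlt => /orP[/eqP -> //|kN /YX].
exact: XN.
Qed.

Lemma maximal_chain_mem {T : Type} {P : set (set T)} {C : set (set T)} (Y : set T) :
  maximal_chain_in P (@subset T) C -> P Y ->
  (forall X, C X -> X `<=` Y \/ Y `<=` X) -> C Y.
Proof.
move=> [[CP Ctot] Cmax] PY Ycmp; have <- : C `|` [set Y] = C.
  apply: Cmax; last by move=> X; left.
  split=> [X [/CP //|->//]|X Z [CX|->] [CZ|->]]; [exact: Ctot|exact: Ycmp| |by left].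
  by case: (Ycmp _ CZ); [right|left].
by right.
Qed.

(** A least member could be shrunk by one point: the result is still infinite and coinfinite and
    comparable with all of [C], so maximality would put it in [C]. *)
Lemma inf_coinf_chain_lt {C : set (set nat)} {X : set nat} :
  maximal_chain_in inf_coinf (@subset nat) C -> C X ->
  exists2 Y, C Y & Y `<=` X /\ Y <> X.
Proof.
move=> Cmax CX; have [[CP Ctot] _] := Cmax; have [Xi Xc] := CP _ CX.
have [n Xn] := infinite_setN0 Xi; apply: contrapT => nY.
have Xmin Y : C Y -> X `<=` Y.
  move=> CY; have [//|YX] := Ctot _ _ CX CY.
  by have [->//|YneX] := pselect (Y = X); case: nY; exists Y.
suff CXn : C (X `\ n) by have [_] := Xmin _ CXn n Xn; apply.
apply: (maximal_chain_mem _ Cmax) => [|Y /Xmin XY]; last by right=> k [/XY].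
split; first by apply: infinite_setD => //; exact: finite_set1.
by apply: sub_infinite_set Xc => k nXk [].
Qed.

Lemma inf_coinf_chain_gt {C : set (set nat)} {X : set nat} :
  maximal_chain_in inf_coinf (@subset nat) C -> C X ->
  exists2 Y, C Y & X `<=` Y /\ X <> Y.
Proof.
move=> Cmax CX; have [[CP Ctot] _] := Cmax; have [Xi Xc] := CP _ CX.
have [n Xn] := infinite_setN0 Xc; apply: contrapT => nY.
have Xtop Y : C Y -> Y `<=` X.
  move=> CY; have [XY|//] := Ctot _ _ CX CY.
  by have [->//|YneX] := pselect (X = Y); case: nY; exists Y.
apply: Xn; have /Xtop : C (n |` X); last by apply; left.
apply: (maximal_chain_mem _ Cmax) => [|Y /Xtop YX]; last by left=> k /YX; right.
split; first by apply: sub_infinite_set Xi => k; right.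
by rewrite setCU setIC -setDE; apply: infinite_setD => //; exact: finite_set1.
Qed.

(** The two added sets become the points 0 and 1 of the compact set. *)
Definition completion (C : set (set nat)) : set (set nat) :=
  C `|` [set \bigcap_(X in C) X; \bigcup_(X in C) X].

Lemma completion_bounds {C : set (set nat)} {X : set nat} :
  C !=set0 -> completion C X ->
  \bigcap_(Y in C) Y `<=` X /\ X `<=` \bigcup_(Y in C) Y.
Proof.
move=> [Z CZ] [CX|[->|->]].
- by split=> [k /(_ _ CX)|k Xk] //; exists X.
- by split=> // k /(_ _ CZ); exists Z.
- by split=> // k /(_ _ CZ); exists Z.
Qed.

Lemma completion_total {C : set (set nat)} :
  C !=set0 -> total_on C (@subset nat) -> total_on (completion C) (@subset nat).
Proof.
move=> C0 Ctot X Y CX CY; have [loX Xhi] := completion_bounds C0 CX.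
have [loY Yhi] := completion_bounds C0 CY.
case: CX => [CX|[->|->]]; [|by left|by right].
by case: CY => [CY|[->|->]]; [exact: Ctot|right|left].
Qed.

(** A finite [Y] contains no member of [C], so it lies below all of them and is the intersection;
    dually a cofinite [Y] is the union. Otherwise maximality of [C] applies. *)
Lemma completion_mem {C : set (set nat)} (Y : set nat) :
    maximal_chain_in inf_coinf (@subset nat) C -> C !=set0 ->
    \bigcap_(X in C) X `<=` Y -> Y `<=` \bigcup_(X in C) X ->
    (forall X, C X -> X `<=` Y \/ Y `<=` X) ->
  completion C Y.
Proof.
move=> Cmax C0 loY Yhi Ycmp; have [[CP _] _] := Cmax.
have [Yfin|Yinf] := pselect (finite_set Y).
  right; left; apply/seteqP; split=> // k Yk X CX.
  have [XY|YX] := Ycmp _ CX; last exact: YX.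
  by have [+ _] := CP _ CX; case; exact: sub_finite_set Yfin.
have [Ycofin|Ycoinf] := pselect (finite_set (~` Y)).
  right; right; apply/seteqP; split=> // k [X CX Xk].
  have [XY|YX] := Ycmp _ CX; first exact: XY.
  by have [_] := CP _ CX; case; apply: sub_finite_set Ycofin; exact: subsetC.
by left; exact: (maximal_chain_mem _ Cmax).
Qed.

Lemma completion_bigcup {C : set (set nat)} (F : set (set nat)) :
    maximal_chain_in inf_coinf (@subset nat) C -> C !=set0 ->
    F !=set0 -> F `<=` completion C ->
  completion C (\bigcup_(X in F) X).
Proof.
move=> Cmax C0 [Z FZ] FC; have Ctot := completion_total C0 Cmax.1.2.
apply: completion_mem => // [k|k [X FX]|X CX].
- by move/(completion_bounds C0 (FC _ FZ)).1; exists Z.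
- exact: (completion_bounds C0 (FC _ FX)).2.
- have [[W FW XW]|nW] := pselect (exists2 W, F W & X `<=` W).
    by left=> k /XW; exists W.
  right=> k [W FW Wk]; have [//|XW] := Ctot W X (FC _ FW) (or_introl CX).
    exact.
  by case: nW; exists W.
Qed.

Lemma completion_bigcap {C : set (set nat)} (F : set (set nat)) :
    maximal_chain_in inf_coinf (@subset nat) C -> C !=set0 ->
    F !=set0 -> F `<=` completion C ->
  completion C (\bigcap_(X in F) X).
Proof.
move=> Cmax C0 [Z FZ] FC; have Ctot := completion_total C0 Cmax.1.2.
apply: completion_mem => // [k lok X FX|k|X CX].
- exact: (completion_bounds C0 (FC _ FX)).1.
- by move/(_ _ FZ)/(completion_bounds C0 (FC _ FZ)).2.
- have [[W FW WX]|nW] := pselect (exists2 W, F W & W `<=` X).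
    by right=> k /(_ _ FW)/WX.
  left=> k Xk W FW; have [WX|] := Ctot W X (FC _ FW) (or_introl CX).
    by case: nW; exists W.
  exact.
Qed.

(** For [n] in [Y] but not in [X], take [U] the union of the members omitting [n] and [V] the
    intersection of those containing [n]; every member is of one kind or the other. *)
Lemma completion_jump {C : set (set nat)} {X Y : set nat} :
    maximal_chain_in inf_coinf (@subset nat) C -> C !=set0 ->
    completion C X -> completion C Y -> X `<=` Y -> X <> Y ->
  exists U V, [/\ completion C U, completion C V, X `<=` U /\ V `<=` Y,
    U `<=` V /\ U <> V & forall W, completion C W -> W `<=` U \/ V `<=` W].
Proof.
move=> Cmax C0 CX CY XY XneY; have Ctot := completion_total C0 Cmax.1.2.
have [n [Yn nXn]] : exists n, Y n /\ ~ X n.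
  apply: contrapT => nn; apply: XneY; apply/seteqP; split=> // n Yn.
  by apply: contrapT => nXn; apply: nn; exists n.
pose FU := [set W | completion C W /\ ~ W n]; pose FV := [set W | completion C W /\ W n].
have FUX : FU X by []. have FVY : FV Y by [].
exists (\bigcup_(W in FU) W), (\bigcap_(W in FV) W); split.
- by apply: completion_bigcup => //; [exists X|move=> W []].
- by apply: completion_bigcap => //; [exists Y|move=> W []].
- by split=> k; [exists X|apply].
- split=> [k [W [CW nWn] Wk] Z [CZ Zn]|UV].
    by have [WZ|/(_ n Zn)//] := Ctot _ _ CW CZ; exact: WZ.
  have : (\bigcap_(W in FV) W) n by move=> W [].
  by rewrite -UV => -[W []].
- move=> W CW; have [Wn|nWn] := pselect (W n).
    by right=> k; apply.
  by left=> k Wk; exists W.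
Qed.

(** * From a maximal chain to a compact nowhere dense set *)

Lemma maximal_chain_compact {R : realType} {d : Order.disp_t} {L : orderType d} :
    [set: L] !=set0 ->
    (exists C : set (set nat), maximal_chain_in inf_coinf (@subset nat) C /\
       order_isomorphic_to L (@subset nat) C) ->
  exists K : set R, [/\ K `<=` `[0, 1], compact K, nowhere_dense K,
    limit_point K 0 /\ limit_point K 1 &
    order_isomorphic_to L real_le (K `\` [set 0; 1])].
Proof.
move=> [x0 _] [C [Cmax [h [[hC hinj hsurj] hle]]]].
have C0 : C !=set0 by exists (h x0); exact: hC.
have [[CP Ctot] _] := Cmax.
have tot := completion_total C0 Ctot.
pose lo := \bigcap_(X in C) X; pose hi := \bigcup_(X in C) X.
have loP X : C X -> lo `<=` X /\ lo <> X.
  move=> CX; split=> [k|loX]; first exact.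
  have [Y CY [YX]] := inf_coinf_chain_lt Cmax CX; apply; apply/seteqP; split=> //.
  by rewrite -loX => k; apply.
have hiP X : C X -> X `<=` hi /\ X <> hi.
  move=> CX; split=> [k|Xhi]; first by exists X.
  have [Y CY [XY]] := inf_coinf_chain_gt Cmax CX; apply; apply/seteqP; split=> //.
  by rewrite Xhi => k; exists Y.
have [lohi loneqhi] : lo `<=` hi /\ lo <> hi.
  have [X CX] := C0; have [loX loneX] := loP _ CX; have [Xhi _] := hiP _ CX.
  split; first exact: subset_trans Xhi.
  by move=> lohiE; apply: loneX; apply/seteqP; split=> //; rewrite lohiE.
have [phi [phi_lo phi_hi phi_lt phi_cont]] := @exists_weight R _ _ lohi loneqhi.
have phi_le A B : A `<=` B -> phi A <= phi B.
  by move=> AB; have [->//|/(phi_lt _ _ AB)/ltW] := pselect (A = B).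
have phi_sub A B : completion C A -> completion C B -> phi A <= phi B -> A `<=` B.
  move=> CA CB AB; have [//|BA] := tot _ _ CA CB.
  have [->//|BneA] := pselect (B = A).
  by have := phi_lt _ _ BA BneA; rewrite ltNge AB.
have Clo : completion C lo by right; left.
have Chi : completion C hi by right; right.
pose K := [set phi X | X in completion C].
have K01 : K `<=` `[0, 1].
  move=> _ [X CX <-]; have [loX Xhi] := completion_bounds C0 CX.
  by rewrite /= in_itv /= -phi_lo -phi_hi !phi_le.
have phi_bigcup F p : F !=set0 -> F `<=` completion C ->
    (forall X, F X -> phi X <= p) -> phi (\bigcup_(X in F) X) <= p.
  move=> F0 FC Fp; apply/ler_addgt0Pr => e /phi_cont[N phiN].
  have Ftot : total_on F (@subset nat) by move=> X Y /FC CX /FC CY; exact: tot.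
  have [X FX /phiN XN] := chain_bigcup_prefix N Ftot F0.
  by apply: (le_trans XN); rewrite lerD2r Fp.
have phi_bigcap F p : F !=set0 -> F `<=` completion C ->
    (forall X, F X -> p <= phi X) -> p <= phi (\bigcap_(X in F) X).
  move=> F0 FC Fp; apply/ler_addgt0Pr => e /phi_cont[N phiN].
  have Ftot : total_on F (@subset nat) by move=> X Y /FC CX /FC CY; exact: tot.
  have [X FX /phiN XN] := chain_bigcap_prefix N Ftot F0.
  by apply: le_trans XN; exact: Fp.
(* If [p] is not a value, split the members by the side of [p] on which their value falls. The union
   of the lower ones and the intersection of the upper ones have values strictly on either side of
   [p], with no value in between. *)
have Kcl : closed K.
  move=> p Kp; apply: contrapT => nKp.
  have /andP[p0 p1] : 0 <= p <= 1.
    have cl01 : closed (`[0, 1] : set R) by exact: interval_closed.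
    by have := cl01 p (closure_subset K01 Kp); rewrite /= in_itv.
  pose FA := [set X | completion C X /\ phi X <= p].
  pose FB := [set X | completion C X /\ p <= phi X].
  have FA0 : FA !=set0 by exists lo; rewrite /FA /= phi_lo.
  have FB0 : FB !=set0 by exists hi; rewrite /FB /= phi_hi.
  have FAC : FA `<=` completion C by move=> X [].
  have FBC : FB `<=` completion C by move=> X [].
  have neq_phi X : completion C X -> phi X != p.
    by move=> CX; apply/eqP => pE; apply: nKp; exists X.
  have Ap : phi (\bigcup_(X in FA) X) < p.
    rewrite lt_neqAle neq_phi ?phi_bigcup //; last exact: completion_bigcup.
    by move=> X [].
  have pB : p < phi (\bigcap_(X in FB) X).
    rewrite lt_neqAle eq_sym neq_phi ?phi_bigcap //; last exact: completion_bigcap.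
    by move=> X [].
  have pAB : p \in `]phi (\bigcup_(X in FA) X), phi (\bigcap_(X in FB) X)[.
    by rewrite in_itv /= Ap.
  have [_ [[X CX <-]]] := Kp _ (near_in_itvoo pAB).
  rewrite /= in_itv /= => /andP[AX XB]; have [Xp|pX] := leP (phi X) p.
    by move: AX; rewrite ltNge phi_le// => k Xk; exists X.
  by move: XB; rewrite ltNge phi_le// => k; apply; split=> //; exact: ltW.
(* A ball inside [K] would contain two values [phi X < phi Y], hence both sides of a jump between
   [X] and [Y]; the midpoint of that gap is in the ball but is no value. *)
have Knd : nowhere_dense K.
  rewrite /nowhere_dense -(closure_id K).1//; apply/seteqP; split=> // p.
  move=> /nbhs_ballP[e /= e0 eK].
  have [X CX Xp] : K p by apply: eK; exact: ballxx.
  have [Y CY Yp] : K (p + e / 2).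
    by apply: eK; rewrite /ball /= ltr_distlC; lra.
  have XYlt : phi X < phi Y by rewrite Xp Yp; lra.
  have XY : X `<=` Y by apply: phi_sub => //; exact: ltW.
  have XneY : X <> Y by move=> XYE; rewrite XYE ltxx in XYlt.
  have [U [V [CU CV [/phi_le XU /phi_le VY] [UV UneV] gap]]] :=
    completion_jump Cmax C0 CX CY XY XneY.
  have UVlt := phi_lt _ _ UV UneV.
  have [W CW Wp] : K ((phi U + phi V) / 2).
    by apply: eK; rewrite /ball /= ltr_distlC; lra.
  by have [/phi_le|/phi_le] := gap _ CW; rewrite Wp; lra.
have phiC01 X : C X -> 0 < phi X < 1.
  move=> CX; have [loX loneX] := loP _ CX; have [Xhi Xnehi] := hiP _ CX.
  by rewrite -phi_lo -phi_hi !phi_lt.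
exists K; split=> //.
- exact: subclosed_compact Kcl (@segment_compact R 0 1) K01.
(* A member of [C] agreeing with [lo], respectively [hi], on a long prefix has value within [e / 2]
   of 0, respectively 1, without reaching it. *)
- split=> U /nbhs_ballP[e /= e0 eU]; have e2 : 0 < e / 2 by lra.
    have [N phiN] := phi_cont _ e2.
    have [X CX /phiN] := chain_bigcap_prefix N Ctot C0; rewrite -/lo phi_lo => Xe.
    have /andP[X0 X1] := phiC01 _ CX; exists (phi X); split; first by rewrite gt_eqF.
      by exists X => //; left.
    by apply: eU; rewrite /ball /= ltr_distlC; lra.
  have [N phiN] := phi_cont _ e2.
  have [X CX /phiN] := chain_bigcup_prefix N Ctot C0; rewrite -/hi phi_hi => Xe.
  have /andP[X0 X1] := phiC01 _ CX; exists (phi X); split; first by rewrite lt_eqF.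
    by exists X => //; left.
  by apply: eU; rewrite /ball /= ltr_distlC; lra.
- have hC' x : completion C (h x) by left; exact: hC.
  exists (phi \o h); split; last first.
    move=> x y; split=> [/hle/phi_le //|hxy]; apply/hle.
    exact: phi_sub.
  split=> [x _|x y _ _ /= hxy|z [[X CX <-] /not_orP[z0 z1]]].
  + have /andP[X0 X1] := phiC01 _ (hC x I); split; first by exists (h x).
    by move=> -[] /= E; move: X0 X1; rewrite E ltxx.
  + apply: hinj; rewrite ?inE //; apply/seteqP.
    by split; apply: phi_sub => //; rewrite hxy.
  + case: CX z0 z1 => [CX _ _|[->|->]].
    * by have [x _ xX] := hsurj _ CX; exists x => //=; rewrite xX.
    * by move=> /(_ phi_lo).
    * by move=> _ /(_ phi_hi).
Qed.

(** Nonemptiness matters: the empty order satisfies the order properties vacuously, yet a maximal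
    chain is never empty. *)
Theorem theorem3p3 (R : realType) (d : Order.disp_t) (L : orderType d)
    (L_nonempty : [set: L] !=set0) :
  [<->
       exists C : set (set nat),
         maximal_chain_in inf_coinf (@subset nat) C /\
         order_isomorphic_to L (@subset nat) C;
       [/\ R_embeddable R L, weakly_boolean L & without_endpoints L];
       exists K : set R,
         [/\ K `<=` `[0, 1], compact K, nowhere_dense K,
             limit_point K 0 /\ limit_point K 1 &
             order_isomorphic_to L real_le (K `\` [set 0; 1])] ].
Proof.
(* The lemmas prove the cycle chain, compact set, order properties, chain; the required cycle runs
   the other way, so each implication composes two of them. *)
tfae.
- by move=> /(maximal_chain_compact (R := R) L_nonempty)/compact_nowhere_dense_boolean.
- by move=> /(embeddable_maximal_chain L_nonempty)/(maximal_chain_compact L_nonempty).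
- by move=> /compact_nowhere_dense_boolean/(embeddable_maximal_chain L_nonempty).
Qed.
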